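(* Let $R$ be a ring, let $C$ be a $1$-cotilting right $R$-module, let $\mathcal Y={}^{\perp_\infty}C$, and let $\mathfrak Y=(\mathcal Y,\mathcal Y^{\perp})$ be the corresponding cotorsion pair. If $C$ is $\Sigma$-pure-injective, then: (1) $\mathfrak Y=\mathfrak Y_1$; (2) the ring $R$ is right coherent.
   Context: Rings are associative with unit. For a class $\mathcal C$ of right $R$-modules, $\mathcal C^{\perp}=\{M \mid \mathrm{Ext}^1_R(D,M)=0 \ \forall D\in\mathcal C\}$, ${}^{\perp}\mathcal C=\{M \mid \mathrm{Ext}^1_R(M,D)=0 \ \forall D\in\mathcal C\}$, ${}^{\perp_\infty}\mathcal C=\{M\mid \mathrm{Ext}^j_R(M,D)=0\ \forall D\in\mathcal C,\ \forall j>0\}$. $\mathrm{Prod}\,C$ is the class of all direct summands of direct products of copies of $C$. A right $R$-module $C$ is $1$-cotilting if $\mathrm{Ext}^j_R(C^{\alpha},C)=0$ for all $j>0$ and all cardinals $\alpha$, $C$ has injective dimension at most $1$, and there is an exact sequence $0\to C_1\to C_0\to W\to 0$ with $W$ an injective cogenerator of $\mathrm{Mod}\text{-}R$ and $C_0,C_1\in\mathrm{Prod}\,C$. $C$ is $\Sigma$-pure-injective if every direct sum $C^{(\alpha)}$ of copies of $C$ is pure-injective. A cotorsion pair is a pair $(\mathcal A,\mathcal B)$ with $\mathcal A={}^{\perp}\mathcal B$, $\mathcal B=\mathcal A^{\perp}$. $\mathcal Y_1$ is the class of finitely presented modules in $\mathcal Y$, and $\mathfrak Y_1=({}^{\perp}(\mathcal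 Y_1^{\perp}),\mathcal Y_1^{\perp})$ is the cotorsion pair generated by $\mathcal Y_1$. *)

(* Defs.v *)
From HB Require Import structures.
From mathcomp Require Import all_boot all_order all_algebra finmap.
From mathcomp Require Import boolp classical_sets functions cardinality fsbigop.

Set Implicit Arguments.
Unset Strict Implicit.
Unset Printing Implicit Defensive.

Import GRing.Theory.

Local Open Scope classical_set_scope.
Local Open Scope ring_scope.

(* Everything below is written for left modules over a ring [S]; right modules
   over [R] are left modules over the converse ring [R^c]. *)
Notation rmodType R := (lmodType R^c).

Section Modules.
Variable S : pzRingType.
Implicit Types M N A B E : lmodType S.

Definition is_surjective A B (f : A -> B) : Prop := forall y, exists x, f x = y.

Definition exact_at A B E (f : A -> B) (g : B -> E) : Prop :=
  forall y, g y = 0 <-> exists x, f x = y.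

Definition short_exact A B E (f : {linear A -> B}) (g : {linear B -> E}) : Prop :=
  [/\ injective f, exact_at f g & is_surjective g].

Definition isomorphic M N : Prop := exists f : {linear M -> N}, bijective f.

Definition projective M : Prop :=
  forall A B (p : {linear A -> B}) (f : {linear M -> B}), is_surjective p ->
  exists g : {linear M -> A}, forall x, p (g x) = f x.

Definition injective_module E : Prop :=
  forall A B (i : {linear A -> B}) (f : {linear A -> E}), injective i ->
  exists g : {linear B -> E}, forall x, g (i x) = f x.

Definition injective_cogenerator E : Prop :=
  injective_module E /\
  forall M (x : M), x <> 0 -> exists f : {linear M -> E}, f x <> 0.

Definition inj_dim_le1 M : Prop :=
  exists (E0 E1 : lmodType S) (i : {linear M -> E0}) (p : {linear E0 -> E1}),
  [/\ injective_module E0, injective_module E1 & short_exact i p].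

Definition finitely_generated M : Prop :=
  exists (n : nat) (p : {linear 'rV[S]_n -> M}), is_surjective p.

Definition finitely_presented M : Prop :=
  exists (m n : nat) (r : {linear 'rV[S]_m -> 'rV[S]_n})
         (p : {linear 'rV[S]_n -> M}), exact_at r p /\ is_surjective p.

(* The direct product C^I is the pointwise module on [I -> C]; the direct sum
   C^(I) is its submodule of finitely supported families. *)
Section DirectSum.
Variables (I : Type) (C : lmodType S).

Definition fin_supp : {pred I -> C} :=
  fun f => `[< finite_set [set i | f i != 0] >].

Lemma fin_suppP (f : I -> C) :
  reflect (finite_set [set i | f i != 0]) (f \in fin_supp).
Proof. exact: asboolP. Qed.

Lemma fin_supp_submod : subsemimod_closed fin_supp.
Proof.
split; first split.
- apply/fin_suppP; rewrite (_ : [set _ | _] = set0) //.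
  by apply/seteqP; split=> i //=; rewrite eqxx.
- move=> f g /fin_suppP ff /fin_suppP fg; apply/fin_suppP.
  have fU : finite_set ([set i | f i != 0] `|` [set i | g i != 0]).
    by rewrite finite_setU.
  apply: sub_finite_set fU => i /=.
  have [f0|f0] := eqVneq (f i) 0; last by left.
  have [g0|g0] := eqVneq (g i) 0; last by right.
  by rewrite -[(f + g) i]/(f i + g i) f0 g0 addr0 eqxx.
- move=> a f /fin_suppP ff; apply/fin_suppP; apply: sub_finite_set ff => i /=.
  by apply: contraNN => /eqP f0; rewrite -[(a *: f) i]/(a *: f i) f0 scaler0.
Qed.

Record dsum : Type := DSum { dsum_val : I -> C; _ : dsum_val \in fin_supp }.

HB.instance Definition _ := [isSub for dsum_val].
HB.instance Definition _ := [Choice of dsum by <:].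
HB.instance Definition _ :=
  GRing.SubChoice_isSubLmodule.Build S (I -> C) fin_supp dsum fin_supp_submod.

End DirectSum.

Definition direct_summand M N : Prop :=
  exists M' : lmodType S, isomorphic (M * M')%type N.

Definition ProdC (C M : lmodType S) : Prop :=
  exists I : Type, direct_summand M (I -> C).

(* Purity of [0 -> A -> B -> E -> 0] is exactness of [Hom (F, -)] on it, for all
   finitely presented [F]. *)
Definition pure_exact A B E (i : {linear A -> B}) (p : {linear B -> E}) : Prop :=
  short_exact i p /\
  forall F : lmodType S, finitely_presented F ->
  forall f : {linear F -> E}, exists g : {linear F -> B}, forall x, p (g x) = f x.

Definition pure_injective M : Prop :=
  forall A B E (i : {linear A -> B}) (p : {linear B -> E}), pure_exact i p ->
  forall f : {linear A -> M}, exists g : {linear B -> M}, forall x, g (i x) = f x.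

Definition Sigma_pure_injective (C : lmodType S) : Prop :=
  forall I : Type, pure_injective (dsum I C).

Record proj_resolution M := ProjResolution {
  res_mod :> nat -> lmodType S;
  res_diff : forall n, {linear res_mod n.+1 -> res_mod n};
  res_aug : {linear res_mod 0 -> M};
  res_proj : forall n, projective (res_mod n);
  res_aug_surj : is_surjective res_aug;
  res_exact0 : exact_at (res_diff 0) res_aug;
  res_exact : forall n, exact_at (res_diff n.+1) (res_diff n) }.

(* [ext_zero j M N] is Ext^j(M, N) = 0, that is, every [j]-cocycle of the
   complex Hom(P, N) is a coboundary, for every projective resolution [P] of
   [M]; resolutions exist by [proj_resolution_exists] below. *)
Definition ext_zero (j : nat) M N : Prop :=
  forall (P : proj_resolution M) (f : {linear P j -> N}),
  (forall x, f (res_diff P j x) = 0) ->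
  match j return {linear P j -> N} -> Prop with
  | 0 => fun f => forall x, f x = 0
  | k.+1 => fun f => exists g : {linear P k -> N}, forall x, f x = g (res_diff P k x)
  end f.

Definition mod_class : Type := lmodType S -> Prop.

Definition rperp (D : mod_class) : mod_class :=
  fun M => forall N, D N -> ext_zero 1 N M.

Definition lperp (D : mod_class) : mod_class :=
  fun M => forall N, D N -> ext_zero 1 M N.

Definition lperp_infty (D : mod_class) : mod_class :=
  fun M => forall N, D N -> forall j, (0 < j)%N -> ext_zero j M N.

Definition fp_part (D : mod_class) : mod_class :=
  fun M => finitely_presented M /\ D M.

Definition generated_pair (D : mod_class) : mod_class * mod_class :=
  (lperp (rperp D), rperp D).

Definition cotilting1 (C : lmodType S) : Prop :=
  [/\ forall (I : Type) (j : nat), (0 < j)%N -> ext_zero j (I -> C) C,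
      inj_dim_le1 C &
      exists (C1 C0 W : lmodType S) (i : {linear C1 -> C0}) (p : {linear C0 -> W}),
        [/\ ProdC C C1, ProdC C C0, injective_cogenerator W & short_exact i p]].

(* The left ideals of [S] are, up to isomorphism, the modules embedding into the
   regular module [S^o]. *)
Definition left_coherent : Prop :=
  forall M (i : {linear M -> S^o}), injective i ->
  finitely_generated M -> finitely_presented M.

End Modules.

Definition right_coherent (R : pzRingType) : Prop := left_coherent R^c.

(* Existence of (free) resolutions, hence non-vacuity of [ext_zero]: cover each
   module by the free module on its elements and iterate on kernels. *)
Section FreeModule.
Variables (S : pzRingType) (X : choiceType).
Local Notation F := (dsum X S^o).

Definition fsupp (u : F) : {fset X} := fset_set [set x | dsum_val u x != 0].

Lemma fsuppP (u : F) x : (x \in fsupp u) = (dsum_val u x != 0).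
Proof.
rewrite in_fset_set; last by apply/fin_suppP; case: u.
by apply/idP/idP => [/set_mem|] // H; apply/mem_set.
Qed.

Definition flin (M : lmodType S) (g : X -> M) (u : F) : M :=
  \sum_(x <- fsupp u) (dsum_val u x : S) *: g x.

Lemma flinE (M : lmodType S) (g : X -> M) (u : F) (A : {fset X}) :
  {subset fsupp u <= A} ->
  flin g u = \sum_(x <- A) (dsum_val u x : S) *: g x.
Proof.
move=> uA; rewrite /flin.
have -> : \sum_(x <- A) (dsum_val u x : S) *: g x =
  \sum_(x <- A | x \in fsupp u) (dsum_val u x : S) *: g x.
  rewrite [RHS]big_mkcond; apply: eq_bigr => x _.
  by rewrite fsuppP; case: eqVneq => //= ->; rewrite scale0r.
rewrite -[RHS]big_filter; apply: perm_big; apply: uniq_perm.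
- exact: fset_uniq.
- exact/filter_uniq/fset_uniq.
- by move=> x; rewrite mem_filter; case: (boolP (x \in fsupp u)) => // /uA ->.
Qed.

Lemma flin_linear (M : lmodType S) (g : X -> M) : linear (flin g).
Proof.
move=> a u v; pose w : F := a *: u + v; rewrite -/w; pose A := (fsupp w `|` (fsupp u `|` fsupp v))%fset.
rewrite !(@flinE _ _ _ A); last 3 first.
- by move=> x; rewrite !inE => ->; rewrite !orbT.
- by move=> x; rewrite !inE => ->; rewrite !orbT.
- by move=> x; rewrite !inE => ->.
rewrite scaler_sumr -big_split; apply: eq_bigr => x _ /=.
by rewrite scalerA -scalerDl.
Qed.

HB.instance Definition _ (M : lmodType S) (g : X -> M) :=
  GRing.isLinear.Build S F M *:%R (flin g) (flin_linear g).

Fact delta_subproof (x : X) :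
  ((fun y => (y == x)%:R) : X -> S^o) \in @fin_supp S X S^o.
Proof.
apply/fin_suppP; apply: (@sub_finite_set _ _ [set x]) => // y /=.
by case: (y =P x) => //= _; rewrite eqxx.
Qed.

Definition fdelta (x : X) : F := DSum (delta_subproof x).

Lemma flin_delta (M : lmodType S) (g : X -> M) x : flin g (fdelta x) = g x.
Proof.
rewrite (@flinE _ _ _ [fset x]%fset) ?big_seq_fset1 /= ?eqxx ?scale1r //.
by move=> y; rewrite fsuppP inE /=; case: (y == x) => //; rewrite eqxx.
Qed.

Lemma flin_unique (M : lmodType S) (f : {linear F -> M}) u :
  f u = flin (fun x => f (fdelta x)) u.
Proof.
have eu : u = \sum_(x <- fsupp u) (dsum_val u x : S) *: fdelta x.
  apply: val_inj; rewrite raddf_sum /=; apply/funext => y; rewrite fct_sumE /=.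
  rewrite (eq_bigr (fun x => (dsum_val u x : S) * (y == x)%:R)) //.
  case: (boolP (y \in fsupp u)) => yu.
    rewrite (bigD1_seq y) ?fset_uniq //= eqxx mulr1 big1 ?addr0 // => x.
    by rewrite eq_sym => /negPf ->; rewrite mulr0.
  rewrite big1_seq; last first.
    move=> x /= xu; case: (y =P x) => [e|_]; last by rewrite mulr0.
    by rewrite e xu in yu.
  by move: yu; rewrite fsuppP negbK => /eqP.
by rewrite {1}eu linear_sum; apply: eq_bigr => x _; rewrite linearZ.
Qed.

Lemma free_projective : projective F.
Proof.
move=> A B p f p_surj.
have [g gP] := choice (fun x => p_surj (f (fdelta x))).
exists (flin g) => u; rewrite [RHS]flin_unique -[LHS]/((p \o flin g) u) flin_unique.
rewrite /flin; apply: eq_bigr => x _; by rewrite /= flin_delta gP.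
Qed.

End FreeModule.

Section Kernel.
Variables (S : pzRingType) (M N : lmodType S) (f : {linear M -> N}).
Definition kernel_pred : {pred M} := fun x => f x == 0.
Lemma kernel_submod : subsemimod_closed kernel_pred.
Proof.
split; first split; rewrite ?unfold_in ?linear0 //.
- by move=> x y; rewrite !unfold_in linearD => /eqP-> /eqP->; rewrite addr0.
- by move=> a x; rewrite !unfold_in linearZ /= => /eqP->; rewrite scaler0.
Qed.
Record kernel_mod : Type := KernelMod { kernel_val : M; _ : kernel_val \in kernel_pred }.
HB.instance Definition _ := [isSub for kernel_val].
HB.instance Definition _ := [Choice of kernel_mod by <:].
HB.instance Definition _ :=
  GRing.SubChoice_isSubLmodule.Build S M kernel_pred kernel_mod kernel_submod.

Lemma kernel_valP (y : M) : f y = 0 <-> exists x : kernel_mod, \val x = y.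
Proof.
split=> [fy0|[[x xP] /= <-]]; last exact/eqP.
have yP : y \in kernel_pred by rewrite unfold_in fy0.
by exists (KernelMod yP).
Qed.
End Kernel.

Section Resolution.
Variables (S : pzRingType) (M : lmodType S).
Definition free_cover (N : lmodType S) : lmodType S := dsum N S^o.
Definition free_cover_map (N : lmodType S) : {linear free_cover N -> N} :=
  @flin S N N id.
Lemma free_cover_surj N : is_surjective (@free_cover_map N).
Proof. by move=> x; exists (@fdelta S N x); apply: flin_delta. Qed.

Fixpoint syz n : lmodType S :=
  if n is k.+1 then kernel_mod (free_cover_map (syz k)) else M.

Definition syz_diff n : {linear free_cover (syz n.+1) -> free_cover (syz n)} :=
  (\val : kernel_mod (free_cover_map (syz n)) -> free_cover (syz n))
    \o free_cover_map (syz n.+1).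

Lemma syz_exact n : exact_at (syz_diff n) (free_cover_map (syz n)).
Proof.
move=> y; rewrite kernel_valP; split=> [[x <-]|[x <-]].
  by have [u <-] := free_cover_surj x; exists u.
by exists (free_cover_map (syz n.+1) x).
Qed.

Lemma proj_resolution_exists : inhabited (proj_resolution M).
Proof.
split; apply: (@ProjResolution _ _ (fun n => free_cover (syz n)) syz_diff
                 (free_cover_map M)).
- by move=> n; apply: free_projective.
- exact: free_cover_surj.
- exact: (@syz_exact 0).
- move=> n y; rewrite -(@syz_exact n.+1 y); split=> y0.
    exact: val_inj.
  exact: (congr1 val y0).
Qed.
End Resolution.

(* Main.v *)
Require Import Defs.
From HB Require Import structures.
From mathcomp Require Import all_boot all_algebra.
From mathcomp Require Import boolp classical_sets functions cardinality.

(** Write Y for the class of modules M with Ext^1(M, C) = 0. As C has injective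
    dimension at most 1, this is also the class where all higher Ext^j(M, C)
    vanish, and it is closed under submodules; as powers of C lie in Y and an
    injective cogenerator W sits in an exact sequence 0 -> C1 -> C0 -> W -> 0
    with C0, C1 in Prod C, the class Y consists of the modules cogenerated by C
    ([cotilting_classP]).

    What Sigma-pure-injectivity contributes is a splitting. For a directed
    index set I, call a family in Q^I eventually zero if it vanishes on all
    indices above some index. For every Q in Prod C the eventually zero
    families are a direct summand of Q^I ([finitely_determined_splits]).
    For I = nat and Q = C they form C^(nat), a pure submodule of C^nat, and the
    splitting is the hypothesis. It forces a descending chain condition
    ([splits_finitely_determined]): along a growing sequence of finite sets, the
    subgroups { h p | h : M -> C vanishes on the finite set } of C become
    stationary. Conversely, under this chain condition a retraction of Q^I can
    be built one element at a time by Zorn's lemma.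

    The splitting is used twice.
    - Let q : N -> M be onto with N, M in Y, and suppose that the maps N -> C
      killing some finite set kill ker q. Then ker q is finitely generated
      ([kernel_finitely_generated]). Otherwise each finite subset s of ker q is
      killed by a nonzero map h_s : ker q -> W; the h_s assemble to a map into
      the eventually zero families of W, which lifts to those of C0, extends to
      N, and by the finiteness hypothesis vanishes in all large coordinates:
      a contradiction. For N free of finite rank this says that the finitely
      generated modules in Y are finitely presented, hence coherence.
    - A directed union of kernels of maps into powers of C is again such a
      kernel ([annihilator_closed_directed_union]), so that Y admits Zorn
      arguments on submodules A' of B with B / A' in Y.

    Together they give a Baer criterion. Let Ext^1(F, X) = 0 for the finitely
    presented F in Y, and let a map to X be given on A with B / A in Y. Take a
    maximal extension of it, defined on some A' with B / A' in Y. If b is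
    outside A', let F be the intersection of the kernels of all maps B / A' -> C
    killing the class of b. By the first use of the splitting F is finitely
    generated, hence finitely presented, and (B / A') / F is in Y, so the map
    extends further ([closed_extension_step]). Hence Ext^1(M, X) = 0 for all M
    in Y, which identifies the two cotorsion pairs. *)

Set Implicit Arguments.
Unset Strict Implicit.
Unset Printing Implicit Defensive.

Import GRing.Theory.
Local Open Scope ring_scope.

(** * Quotient modules and linear maps given by graphs *)

Section QuotientModule.
Local Open Scope quotient_scope.
Variables (S : pzRingType) (B : lmodType S) (U : zmodClosed B).
Hypothesis UZ : forall (k : S) (x : B), x \in U -> k *: x \in U.

(** The proof that [U] is stable under scaling is a parameter, because the
    module instance on the quotient group depends on it. *)
Definition lquot (_ : forall (k : S) (x : B), x \in U -> k *: x \in U) : Type :=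
  Quotient.quot U.
Local Notation Q := (lquot UZ).
HB.instance Definition _ := GRing.Zmodule.copy Q (Quotient.quot U).
Definition lquot_pi (x : B) : Q := \pi_(Quotient.quot U) x.
Definition lquot_scale (k : S) (y : Q) : Q := lquot_pi (k *: repr (y : Quotient.quot U)).

Lemma lquot_piE x y : (lquot_pi x = lquot_pi y) <-> (x - y \in U).
Proof. by rewrite Quotient.idealrBE; split=> [/eqP|/eqP]. Qed.

Lemma lquot_piD x y : lquot_pi (x + y) = lquot_pi x + lquot_pi y.
Proof. by rewrite /lquot_pi [LHS]raddfD. Qed.

Lemma lquot_reprK y : lquot_pi (repr (y : Quotient.quot U)) = y.
Proof. exact: reprK. Qed.

Lemma lquot_scalepi k x : lquot_scale k (lquot_pi x) = lquot_pi (k *: x).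
Proof. by apply/lquot_piE; rewrite -scalerBr UZ //; apply/lquot_piE/lquot_reprK. Qed.

Fact lquot_scalerA a b v : lquot_scale a (lquot_scale b v) = lquot_scale (a * b) v.
Proof. by rewrite -[v]lquot_reprK !lquot_scalepi scalerA. Qed.
Fact lquot_scale1r : left_id 1 lquot_scale.
Proof. by move=> v; rewrite -[v]lquot_reprK !lquot_scalepi scale1r. Qed.
Fact lquot_scalerDr : right_distributive lquot_scale +%R.
Proof.
move=> a v w; rewrite -[v]lquot_reprK -[w]lquot_reprK -lquot_piD.
by rewrite !lquot_scalepi -lquot_piD scalerDr.
Qed.
Fact lquot_scalerDl v : {morph lquot_scale^~ v : a b / a + b}.
Proof. by move=> a b; rewrite -[v]lquot_reprK !lquot_scalepi -lquot_piD scalerDl. Qed.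

HB.instance Definition _ := GRing.Zmodule_isLmodule.Build S Q
  lquot_scalerA lquot_scale1r lquot_scalerDr lquot_scalerDl.

End QuotientModule.

Section Linear.
Variable S : pzRingType.
Implicit Types A B X : lmodType S.

Definition linear_of A B (f : A -> B) (f_lin : linear f) : {linear A -> B} :=
  HB.pack f (GRing.isLinear.Build _ _ _ _ f f_lin).

(** Functionality is only required at 0: this suffices for a graph that is
    closed under linear combinations. *)
Lemma linear_of_graph A B (G : A -> B -> Prop) :
  (forall a, exists b, G a b) -> (forall b, G 0 b -> b = 0) ->
  (forall k a a' b b', G a b -> G a' b' -> G (k *: a + a') (k *: b + b')) ->
  exists g : {linear A -> B}, forall a b, G a b <-> g a = b.
Proof.
move=> Gtot G0 Glin; have [g gP] := choice Gtot.
have Gfun a b : G a b -> g a = b.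
  move=> Gab; have := Glin (-1) _ _ _ _ Gab (gP a).
  by rewrite !scaleN1r addNr => /G0/eqP; rewrite addrC subr_eq0 => /eqP.
have glin : linear g by move=> k a a'; apply: Gfun; apply: Glin.
pose gL := linear_of glin.
by exists gL => a b; split=> [/Gfun//|<-]; apply: gP.
Qed.

Definition submodule_set B (U : set B) :=
  U 0 /\ forall k x y, U x -> U y -> U (k *: x + y).

Lemma quotient_exists B (U : set B) : submodule_set U ->
  exists (Q : lmodType S) (p : {linear B -> Q}), is_surjective p /\
    forall x, p x = 0 <-> U x.
Proof.
move=> [U0 Ulin]; pose P : {pred B} := fun x => `[< U x >].
have PZ (k : S) (x : B) : x \in P -> k *: x \in P.
  by move=> /asboolP Ux; apply/asboolP; rewrite -[_ *: _]addr0; apply: Ulin.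
have Pzm : zmod_closed P.
  split; first exact/asboolP.
  move=> x y /asboolP Ux /asboolP Uy; apply/asboolP.
  by rewrite addrC -scaleN1r; apply: Ulin.
pose PC : zmodClosed B := HB.pack P (GRing.isZmodClosed.Build _ P Pzm).
pose p := @lquot_pi S B PC PZ.
have plin : linear p.
  by move=> k x y; rewrite [LHS]lquot_piD /p -(@lquot_scalepi S B PC PZ).
pose pL : {linear B -> lquot (U:=PC) PZ} := linear_of plin.
exists (lquot (U:=PC) PZ), pL; split.
  by move=> y; exists (repr (y : Quotient.quot PC)); apply: lquot_reprK.
move=> x; rewrite -(linear0 pL); split.
  by move=> /lquot_piE; rewrite subr0 => /asboolP.
by move=> Ux; apply/lquot_piE; rewrite subr0; apply/asboolP.
Qed.
End Linear.

(** * Vanishing of Ext *)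

Section Ext.
Variable S : pzRingType.
Implicit Types A B C E M N Q U V X : lmodType S.

Lemma factor_through A B X (p : {linear A -> B}) (f : {linear A -> X}) :
  is_surjective p -> (forall a, p a = 0 -> f a = 0) ->
  exists g : {linear B -> X}, forall a, g (p a) = f a.
Proof.
move=> p_surj fp0.
have [||k b b' x x' [a [<- <-]] [a' [<- <-]]|g gP] :=
  @linear_of_graph _ B X (fun b x => exists a, p a = b /\ f a = x).
- by move=> b; have [a pa] := p_surj b; exists (f a), a.
- by move=> x [a [/fp0 + <-]].
- by exists (k *: a + a'); rewrite !linearP.
- by exists g => a; apply/gP; exists a.
Qed.

Lemma factor_into A X U (i : {linear X -> U}) (f : {linear A -> U}) :
  injective i -> (forall a, exists x, i x = f a) ->
  exists g : {linear A -> X}, forall a, i (g a) = f a.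
Proof.
move=> i_inj fi.
have [||k a a' x x' /= ix ix'|g gP] :=
  @linear_of_graph _ A X (fun a x => i x = f a).
- exact: fi.
- by move=> x ix; apply: i_inj; rewrite ix !linear0.
- by rewrite !linearP ix ix'.
- by exists g => a; apply/gP.
Qed.

(** The long exact sequence turned into a definition: it characterizes
    Ext^1(M, X) = 0 without reference to resolutions, see [ext1_vanishes]. *)
Definition ext_vanishes M X : Prop :=
  forall A B (i : {linear A -> B}) (p : {linear B -> M}), short_exact i p ->
  forall f : {linear A -> X}, exists g : {linear B -> X}, forall a, g (i a) = f a.

(** One direction is a diagram chase from a resolution of [M] to the given
    extension; the other applies the definition to the first syzygy of [M]. *)
Lemma ext1_vanishes M X : ext_zero 1 M X <-> ext_vanishes M X.
Proof.
split=> [ext0 A B i p [i_inj ip p_surj] f|ext0 P f fd0].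
  have [P] := proj_resolution_exists M.
  have [t tP] := @res_proj _ _ P 0 _ _ _ (res_aug P) p_surj.
  have d0_aug w : res_aug P (res_diff P 0 w) = 0 by apply/res_exact0; exists w.
  have [h hP] : exists h : {linear P 1%N -> A},
      forall w, i (h w) = t (res_diff P 0 w).
    apply: (@factor_into _ _ _ i (t \o res_diff P 0)) => // w.
    by apply/ip; rewrite /= tP d0_aug.
  have hd w : f (h (res_diff P 1 w)) = 0.
    rewrite (_ : h _ = 0) ?linear0 //; apply: i_inj.
    rewrite hP (_ : res_diff P 0 _ = 0) ?linear0 //.
    by apply/res_exact; exists w.
  have [g gP] := ext0 P (f \o h) hd.
  have [||k b b' x x'|G GP] := @linear_of_graph _ B X
     (fun b x => exists a z, b = t z + i a /\ x = f a + g z).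
  - move=> b; have [z zP] := res_aug_surj P (p b).
    have [a aP] : exists a, i a = b - t z.
      by apply/ip; rewrite linearB tP zP subrr.
    by exists (f a + g z), a, z; rewrite aP addrC subrK.
  - move=> x [a [z [tia ->]]].
    have pz : res_aug P z = 0.
      rewrite -tP; have /eqP := congr1 p tia.
      have -> : p (t z + i a) = p (t z).
        by rewrite linearD (_ : p (i a) = 0) ?addr0 //; apply/ip; exists a.
      by rewrite linear0 eq_sym => /eqP.
    have [w wP] := (res_exact0 z).1 pz.
    have -> : a = h (- w).
      apply: i_inj; rewrite hP linearN wP linearN.
      by apply/eqP; rewrite -addr_eq0 addrC -tia.
    rewrite -[f _]/((f \o h) (- w)) linearN gP -wP addNr //.
  - move=> [a [z [-> ->]]] [a' [z' [-> ->]]].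
    exists (k *: a + a'), (k *: z + z'); rewrite !linearP !scalerDr.
    by split; rewrite addrACA.
  - exists G => a; apply/GP; exists a, 0.
    by rewrite !linear0 add0r addr0.
pose aug := res_aug P; pose K := kernel_mod aug.
have [d dP] : exists d : {linear P 1%N -> K},
    forall w, \val (d w) = res_diff P 0 w.
  apply: (@factor_into _ _ _ (\val : K -> P 0%N) (res_diff P 0)).
    exact: val_inj.
  by move=> w; apply/kernel_valP/res_exact0; exists w.
have d_surj : is_surjective d.
  move=> y; have /res_exact0[w wP] : aug (\val y) = 0 by apply/kernel_valP; exists y.
  by exists w; apply: val_inj; rewrite dP.
have [f' f'P] : exists f' : {linear K -> X}, forall w, f' (d w) = f w.
  apply: factor_through => // w dw0.
  have /res_exact[v <-] : res_diff P 0 w = 0 by rewrite -dP dw0.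
  exact: fd0.
have [|g gP] := ext0 K (P 0%N) (\val : K -> P 0%N) aug _ f'.
- split; [exact: val_inj|exact: kernel_valP|exact: res_aug_surj].
- by exists g => w; rewrite -f'P -gP -dP.
Qed.

(** Pull the extension [U] of [V] back along [f]: the pullback is an extension
    of [M] by [X], which splits. *)
Lemma ext_vanishes_lift M X U V (i : {linear X -> U}) (p : {linear U -> V})
    (f : {linear M -> V}) :
  ext_vanishes M X -> short_exact i p ->
  exists g : {linear M -> U}, forall m, p (g m) = f m.
Proof.
move=> ext0 [i_inj ip p_surj].
pose d : U * M -> V := fun u => p u.1 - f u.2.
have dlin : linear d.
  by move=> k u v; rewrite /d /= !linearP scalerDr addrACA.
pose dL := linear_of dlin.
(* K is the pullback of p and f. *)
pose K := kernel_mod dL.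
have KP (y : K) : p (\val y).1 = f (\val y).2.
  by apply/eqP; rewrite -subr_eq0; apply/eqP; apply: ((kernel_valP dL _).2); exists y.
pose j0 : X -> U * M := fun x => (i x, 0).
have j0lin : linear j0.
  move=> k x y; rewrite /j0 linearP /=.
  by congr pair; rewrite /= scaler0 addr0.
pose j0L := linear_of j0lin.
have [j jP] : exists j : {linear X -> K}, forall x, \val (j x) = j0L x.
  apply: (@factor_into _ _ _ (\val : K -> (U * M)%type) j0L); first exact: val_inj.
  move=> x; apply/kernel_valP; rewrite /= /d /= linear0 subr0.
  by apply/ip; exists x.
have [|r rP] := ext0 X K j (snd \o \val) _ idfun.
  split.
  - move=> x y /(congr1 \val); rewrite !jP => -[]; exact: i_inj.
  - move=> y /=; split=> [y0|[x <-]]; last by rewrite jP.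
    have [x ix] : exists x, i x = (\val y).1 by apply/ip; rewrite KP y0 linear0.
    exists x; apply: val_inj; rewrite jP /= /j0 ix -y0.
    exact/esym/surjective_pairing.
  - move=> m; have [u pu] := p_surj (f m).
    have [y yP] : exists y : K, \val y = (u, m).
      by apply/kernel_valP; rewrite /= /d /= pu subrr.
    by exists y; rewrite /= yP.
have [|||g gP] := @linear_of_graph _ M U (fun m u =>
  exists y : K, (\val y).2 = m /\ u = (\val y).1 - i (r y)).
- move=> m; have [u pu] := p_surj (f m).
  have [y yP] : exists y : K, \val y = (u, m).
    by apply/kernel_valP; rewrite /= /d /= pu subrr.
  by exists (u - i (r y)), y; rewrite yP.
- move=> _ [y [y2 ->]].
  have [x ix] : exists x, i x = (\val y).1 by apply/ip; rewrite KP y2 linear0.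
  have -> : y = j x.
    apply: val_inj; rewrite jP /= /j0 ix -y2; exact: surjective_pairing.
  by rewrite rP jP /= subrr.
- move=> k m m' _ _ [y [<- ->]] [y' [<- ->]]; exists (k *: y + y'); split=> //.
  by rewrite !linearP /= scalerDr addrACA.
exists g => m; have [y [<- ->]] := (gP m (g m)).2 erefl.
rewrite linearB KP (_ : p (i _) = 0) ?subr0 //; by apply/ip; eexists.
Qed.

(** Dimension shifting along 0 -> C -> E0 -> E1 -> 0: a cocycle becomes a
    coboundary in E0, and the primitive h found there can be corrected by a map
    h2 from the next projective so that it takes values in C. *)
Lemma inj_dim_le1_ext_higher C M j : inj_dim_le1 C -> ext_zero j.+2 M C.
Proof.
move=> [E0 [E1 [i [p [E0_inj E1_inj [i_inj ip p_surj]]]]]] P f fd.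
have dd n w : res_diff P n (res_diff P n.+1 w) = 0 by apply/res_exact; exists w.
(* A map into an injective module that kills the boundaries factors through
   the image of P n.+1 in P n, hence extends to P n. *)
have ext E n (h : {linear P n.+1 -> E}) : injective_module E ->
    (forall w, h (res_diff P n.+1 w) = 0) ->
    exists g : {linear P n -> E}, forall w, g (res_diff P n w) = h w.
  move=> E_inj hd.
  have [|Q [q [q_surj qP]]] := @quotient_exists _ (P n.+1) (fun w => res_diff P n w = 0).
    by split=> [|k x y x0 y0]; rewrite ?linear0 ?linearP ?x0 ?y0 ?scaler0 ?addr0.
  have [dq dqP] := @factor_through _ _ _ q (res_diff P n) q_surj (fun w => (qP w).1).
  have [|hq hqP] := @factor_through _ _ _ q h q_surj.
    by move=> w /qP/res_exact[v <-]; apply: hd.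
  have [|g gP] := E_inj _ _ dq hq.
    move=> x y; have [a <-] := q_surj x; have [b <-] := q_surj y.
    rewrite !dqP => /eqP; rewrite -subr_eq0 -linearB => /eqP/qP/eqP.
    by rewrite linearB subr_eq0 => /eqP.
  by exists g => w; rewrite -hqP -gP dqP.
have [|h hP] := ext E0 _ (i \o f) E0_inj.
  by move=> w; rewrite /= fd linear0.
have [|h' h'P] := ext E1 j (p \o h) E1_inj.
  by move=> w; rewrite /= hP; apply/ip; exists (f w).
have [h2 h2P] := @res_proj _ _ P j _ _ _ h' p_surj.
pose k := fun w => h w - h2 (res_diff P j w).
have klin : linear k by move=> a x y; rewrite /k !linearP /= scalerDr addrACA.
pose kL := linear_of klin.
have [|g gP] := @factor_into _ _ _ i kL i_inj.
  by move=> w; apply/ip; rewrite /= /k linearB h2P h'P subrr.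
exists g => w; apply: i_inj; rewrite gP /= /k.
by rewrite dd linear0 subr0 hP.
Qed.

(** This is the surjection Ext^1(M, C) -> Ext^1(M', C), which comes from
    Ext^2(M / M', C) = 0; the injective coresolution of [C] gives it directly. *)
Lemma ext_vanishes_sub C M M' (u : {linear M' -> M}) : inj_dim_le1 C -> injective u ->
  ext_vanishes M C -> ext_vanishes M' C.
Proof.
move=> [E0 [E1 [i [q [E0_inj E1_inj iq]]]]] u_inj ext0 A B v p [v_inj vp p_surj] f.
have [i_inj iqP q_surj] := iq.
have [h hP] := E0_inj _ _ v (i \o f) v_inj.
have [|k kP] := @factor_through _ _ _ p (q \o h) p_surj.
  by move=> b /vp[a <-] /=; rewrite hP; apply/iqP; exists (f a).
have [k' k'P] := E1_inj _ _ u k u_inj.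
have [l lP] := ext_vanishes_lift k' ext0 iq.
pose g := fun b => h b - l (u (p b)).
have glin : linear g by move=> a x y; rewrite /g !linearP /= scalerDr addrACA.
pose gL := linear_of glin.
have [|g' g'P] := @factor_into _ _ _ i gL i_inj.
  by move=> b; apply/iqP; rewrite /= /g linearB lP k'P kP subrr.
have pva a : p (v a) = 0 by apply/vp; exists a.
by exists g' => a; apply: i_inj; rewrite g'P /= /g hP pva !linear0 addr0.
Qed.

Fact pi_map_linear (I : Type) M N (h : I -> {linear M -> N}) :
  linear (fun x => (fun i => h i x) : I -> N).
Proof. by move=> k x y; apply/funext => i; rewrite linearP. Qed.

Definition pi_map (I : Type) M N (h : I -> {linear M -> N}) : {linear M -> (I -> N)} :=
  linear_of (pi_map_linear h).

Fact pi_proj_linear (I : Type) N (i : I) : linear (fun x : I -> N => x i).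
Proof. by []. Qed.

Definition pi_proj (I : Type) N (i : I) : {linear (I -> N) -> N} :=
  linear_of (@pi_proj_linear I N i).

Definition retract_of M N : Prop :=
  exists (u : {linear M -> N}) (v : {linear N -> M}), forall x, v (u x) = x.

Lemma direct_summand_retract M N : direct_summand M N -> retract_of M N.
Proof.
move=> [M' [f [g fK gK]]].
have [||k b b' a a' <- <-|g' g'P] :=
  @linear_of_graph _ N (M * M')%type (fun b a => f a = b).
- by move=> b; exists (g b).
- by move=> a fa; rewrite -[a]fK fa -[0 in LHS](linear0 f) fK.
- by rewrite linearP.
pose u0 : M -> M * M' := fun x => (x, 0).
have u0lin : linear u0.
  by move=> k x y; rewrite /u0; congr pair; rewrite /= scaler0 addr0.
pose uL := linear_of u0lin.
exists (f \o uL), (fst \o g') => x /=.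
by rewrite ((g'P _ (u0 x)).1 erefl).
Qed.

Lemma ext_vanishes_pi (I : Type) M X : ext_vanishes M X -> ext_vanishes M (I -> X).
Proof.
move=> ext0 A B i p ip f.
have [g gP] := choice (fun j => ext0 _ _ _ _ ip (@pi_proj I X j \o f)).
by exists (pi_map g) => a; apply/funext => j; rewrite /= /pi_map gP.
Qed.

Lemma ext_vanishes_retract M X N :
  retract_of X N -> ext_vanishes M N -> ext_vanishes M X.
Proof.
move=> [u [v uK]] ext0 A B i p ip f; have [g gP] := ext0 _ _ _ _ ip (u \o f).
by exists (v \o g) => a; rewrite /= gP /= uK.
Qed.

Lemma ext_vanishes_Prod C M X : ProdC C X -> ext_vanishes M C -> ext_vanishes M X.
Proof.
move=> [I /direct_summand_retract XI] /(@ext_vanishes_pi I).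
exact: ext_vanishes_retract.
Qed.

End Ext.

(** * Free and finitely generated modules *)

Section RowVectors.
Variables (S : pzRingType) (n : nat) (M : lmodType S).

Lemma rV_linear_ext (f g : {linear 'rV[S]_n -> M}) :
  (forall i, f (delta_mx 0 i) = g (delta_mx 0 i)) -> forall u, f u = g u.
Proof.
move=> fg u; rewrite [u]row_sum_delta !linear_sum.
by apply: eq_bigr => i _; rewrite !linearZ fg.
Qed.

Lemma rV_linear_of (v : 'I_n -> M) :
  exists g : {linear 'rV[S]_n -> M}, forall i, g (delta_mx 0 i) = v i.
Proof.
pose g := fun u : 'rV[S]_n => \sum_i u 0 i *: v i.
have g_lin : linear g.
  move=> k x y; rewrite /g scaler_sumr -big_split; apply: eq_bigr => i _ /=.
  by rewrite !mxE scalerDl scalerA.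
exists (linear_of g_lin) => i /=; rewrite /g (bigD1 i) //= big1 ?addr0.
  by rewrite mxE !eqxx scale1r.
by move=> j ji; rewrite mxE eqxx (negPf ji) scale0r.
Qed.
End RowVectors.

Section FinitelyGenerated.
Variable S : pzRingType.
Implicit Types M W X : lmodType S.

Lemma projective_ext_vanishes M X : projective M -> ext_vanishes M X.
Proof.
move=> M_proj A B i p [i_inj ip p_surj] f.
have [s sP] := M_proj _ _ p idfun p_surj.
have [|g gP] := @factor_into _ B A B i (idfun \- (s \o p)) i_inj.
  by move=> b; apply: (ip _).1; rewrite /= linearB sP subrr.
exists (f \o g) => a /=; congr (f _); apply: i_inj.
have pia : p (i a) = 0 by apply/ip; exists a.
by rewrite gP /= pia linear0 subr0.
Qed.

Lemma rV_projective n : projective 'rV[S]_n.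
Proof.
move=> A B p f p_surj; have [v vP] := choice (fun j => p_surj (f (delta_mx 0 j))).
have [g gP] := rV_linear_of v; exists g.
by apply: (@rV_linear_ext _ _ _ (p \o g)) => j /=; rewrite gP.
Qed.

Lemma regular_projective : projective (S^o : lmodType S).
Proof.
move=> A B p f p_surj; have [a pa] := p_surj (f 1).
have g_lin : linear (fun x : S^o => (x : S) *: a).
  by move=> k x y; rewrite scalerDl scalerA.
by exists (linear_of g_lin) => x /=; rewrite linearZ pa -linearZ /= [_ *: _]mulr1.
Qed.

Definition vanishes_on M X (s : seq M) (h : {linear M -> X}) : Prop :=
  forall x, x \in s -> h x = 0.

(** If [g] is the map from a free module of finite rank onto the span of [s],
    then the cokernel of [g] is nonzero, hence has a nonzero map to [W]. *)
Lemma vanishing_map_exists M W : injective_cogenerator W -> ~ finitely_generated M ->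
  forall s : seq M, exists2 h : {linear M -> W}, vanishes_on s h & exists x, h x <> 0.
Proof.
move=> [_ W_cog] nfg s.
have [g gP] := @rV_linear_of S (size s) M (fun i => nth 0 s i).
have [Q [q [q_surj qP]]] : exists (Q : lmodType S) (q : {linear M -> Q}),
    is_surjective q /\ forall x, q x = 0 <-> exists u, g u = x.
  apply: quotient_exists; split=> [|k _ _ [u <-] [v <-]].
    by exists 0; rewrite linear0.
  by exists (k *: u + v); rewrite linearP.
have [x xg] : exists x, q x <> 0.
  apply: contrapT => nx; apply: nfg; exists (size s), g => x.
  by apply/qP; apply: contrapT => qx; apply: nx; exists x.
have [f fx] := W_cog _ _ xg; exists (f \o q); last by exists x.
move=> y /(nthP 0)[i si <-] /=.
rewrite (_ : q _ = 0) ?linear0 //; apply/qP.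
by exists (delta_mx 0 (Ordinal si)); rewrite gP.
Qed.

End FinitelyGenerated.

(** * Eventually zero families and the chain condition *)

Section EventuallyZero.
Variable S : pzRingType.
Implicit Types M Q : lmodType S.

Definition directed (I : Type) (le : I -> I -> Prop) : Prop :=
  [/\ inhabited I, forall i j k, le i j -> le j k -> le i k &
      forall i j, exists k, le i k /\ le j k].

Definition evzero (I : Type) (le : I -> I -> Prop) Q (f : I -> Q) : Prop :=
  exists i, forall j, le i j -> f j = 0.

(** The retraction is an endomorphism of the power rather than a map to a module
    of eventually zero families, so that it composes with coordinate maps. *)
Definition evzero_splits (I : Type) (le : I -> I -> Prop) Q : Prop :=
  exists r : {linear (I -> Q) -> (I -> Q)},
    (forall f, evzero le (r f)) /\ forall f, evzero le f -> r f = f.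

Lemma cut_exists (I : Type) (Z : set I) Q :
  exists2 c : {linear (I -> Q) -> (I -> Q)},
    forall f i, Z i -> c f i = 0 & forall f i, ~ Z i -> c f i = f i.
Proof.
exists (pi_map (fun i =>
  if `[< Z i >] then (\0 : {linear (I -> Q) -> Q}) else pi_proj Q i)).
  by move=> f i Zi /=; case: asboolP.
by move=> f i Zi /=; case: asboolP.
Qed.

Section Directed.
Variables (I : Type) (le : I -> I -> Prop).
Hypothesis le_dir : directed le.

Lemma evzero_linear Q k (f g : I -> Q) :
  evzero le f -> evzero le g -> evzero le (k *: f + g).
Proof.
have [_ tr ub] := le_dir.
move=> [i fi] [j gj]; have [l [il jl]] := ub i j; exists l => m lm.
rewrite -[LHS]/(k *: f m + g m) fi ?gj ?scaler0 ?addr0 //; last exact: tr il lm.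
exact: tr jl lm.
Qed.

Lemma evzero_seq (T : eqType) Q (f : T -> I -> Q) (s : seq T) :
  (forall x, x \in s -> evzero le (f x)) ->
  exists i, forall x, x \in s -> forall j, le i j -> f x j = 0.
Proof.
have [[i0] tr ub] := le_dir.
elim: s => [_|x s IHs fs]; first by exists i0.
have [i iP] := IHs (fun y ys => fs y (mem_behead (s := x :: s) ys)).
have [i' i'P] := fs x (mem_head x s); have [k [ik i'k]] := ub i i'.
exists k => y; rewrite inE => /orP[/eqP->|ys] j kj; first exact/i'P/(tr _ _ _ i'k).
exact/(iP y ys)/(tr _ _ _ ik).
Qed.
End Directed.

Lemma leq_directed : directed (fun i j : nat => (i <= j)%N).
Proof.
split; [exact: inhabits 0%N|by move=> i j k; apply: leq_trans|].
by move=> i j; exists (maxn i j); rewrite leq_maxl leq_maxr.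
Qed.

Lemma evzero_nat_fin_supp Q (f : nat -> Q) :
  evzero (fun i j : nat => (i <= j)%N) f <-> f \in fin_supp (I := nat) (C := Q).
Proof.
split=> [[n fn]|/fin_suppP/finite_seqP[s sP]].
  apply/fin_suppP; apply: (@sub_finite_set _ _ (`I_n)%classic); last exact: finite_II.
  by move=> i /= fi; rewrite ltnNge; apply: contra_neqN fi => /fn.
exists (\max_(i <- s) i).+1 => j sj; apply/eqP; apply/negPn/negP => fj.
have : (j \in s) by have : ([set i | f i != 0]%classic j) by []; rewrite sP.
move=> js; move: sj; rewrite ltnNge (big_rem j) //= leq_maxl //.
Qed.

(** For the order of [nat] the eventually zero families are Q^(nat), which is
    pure in Q^nat and pure-injective by hypothesis. *)
Lemma Sigma_pure_injective_splits Q : Sigma_pure_injective Q ->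
  evzero_splits (fun i j : nat => (i <= j)%N) Q.
Proof.
move=> spi; pose ev := @evzero nat (fun i j : nat => (i <= j)%N) Q.
have evl (k : S) f g : ev f -> ev g -> ev (k *: f + g).
  exact: evzero_linear leq_directed _ _ _ _.
have [E [p [p_surj pP]]] : exists (E : lmodType S) (p : {linear (nat -> Q) -> E}),
  is_surjective p /\ forall x, p x = 0 <-> ev x.
  by apply: quotient_exists; split=> [|k f g]; [exists 0%N|apply: evl].
pose D := dsum nat Q; pose i := (\val : D -> nat -> Q).
have iP f : ev f <-> exists d, i d = f.
  split=> [/evzero_nat_fin_supp fP|[[d dP] <-]]; first by exists (DSum fP).
  exact/evzero_nat_fin_supp.
have [|r rP] := spi nat D (nat -> Q) E i p _ idfun.
  split; first by split=> //; move=> f; rewrite pP iP.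
  move=> F [m [n [r [q [rq q_surj]]]]] f.
  have [v vP] := choice (fun j => p_surj (f (q (delta_mx 0 j)))).
  have [V VP] := rV_linear_of v.
  have pV x : p (V x) = f (q x).
    apply: (@rV_linear_ext S n E (p \o V) (f \o q)) => j.
    by rewrite /= VP vP.
  have [N NP] : exists N, forall k : 'I_m, k \in enum 'I_m -> forall j, (N <= j)%N ->
      V (r (delta_mx 0 k)) j = 0.
    apply: (@evzero_seq _ _ leq_directed _ Q (fun k => V (r (delta_mx 0 k)))) => k _.
    by apply/pP; rewrite pV (_ : q _ = 0) ?linear0 //; apply/rq; eexists.
  have [tail tail_in tail_out] := cut_exists (fun j => (j < N)%N) Q.
  (* Only finitely many relations r e_k have to be respected, so V respects
     them all once its first N coordinates are dropped; this does not change V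
     modulo C^(nat). *)
  have [|g gP] := @factor_through _ _ _ _ q (tail \o V) q_surj.
    move=> x /rq[y <-]; apply: (@rV_linear_ext S m _ (tail \o V \o r) \0) => k.
    apply/funext => j /=; case: (ltnP j N) => jN; first by rewrite tail_in.
    rewrite tail_out; last by apply/negP; rewrite -leqNgt.
    by apply: NP; rewrite ?mem_enum.
  exists g => y; have [x <-] := q_surj y; rewrite gP -pV.
  apply/eqP; rewrite -subr_eq0 -linearB; apply/eqP/pP; exists N => j Nj /=.
  rewrite -[LHS]/(tail (V x) j - V x j) tail_out ?subrr //.
  by apply/negP; rewrite -leqNgt.
exists (i \o r); split=> [f|f /iP[d <-]].
  by apply/iP; exists (r f).
by rewrite /= rP.
Qed.

(** The descending chain condition on the subgroups
    { h p | h : M -> Q vanishes on s } of [Q], for [s] a finite subset of [X], in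
    the form in which it is used: some [s] gives the least of these subgroups. *)
Definition finitely_determined Q : Prop :=
  forall M (X : set M) (p : M), exists2 s : seq M, (forall x, x \in s -> X x) &
  forall (h : {linear M -> Q}), vanishes_on s h ->
  forall t : seq M, (forall x, x \in t -> X x) ->
  exists2 h' : {linear M -> Q}, vanishes_on (s ++ t) h' & h' p = h p.

(** A failure yields growing finite sets s_n and maps h_n killing s_n such that
    h_n p is no value at p of a map killing s_(n+1). The retraction then sends
    the sequence (h_n p) to a sequence without zero entries, although its image
    consists of eventually zero sequences. *)
Lemma splits_finitely_determined Q :
  evzero_splits (fun i j : nat => (i <= j)%N) Q -> finitely_determined Q.
Proof.
move=> [r [r_ev r_id]] M X p; apply: contrapT => no_s.
have step (s : seq M) : exists ht : {linear M -> Q} * seq M,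
    (forall x, x \in s -> X x) ->
  [/\ vanishes_on s ht.1, forall x, x \in ht.2 -> X x &
      forall h', vanishes_on (s ++ ht.2) h' -> h' p <> ht.1 p].
  have [sX|sX] := pselect (forall x, x \in s -> X x); last first.
    by exists ((\0 : {linear M -> Q}), [::]).
  apply: contrapT => no_ht; apply: no_s; exists s => // h hs t tX.
  apply: contrapT => no_h'; apply: no_ht; exists (h, t); split=> // h' h'0 h'p.
  by apply: no_h'; exists h'.
have [F FP] := choice step.
pose s_ := fix s_ n := if n is k.+1 then s_ k ++ (F (s_ k)).2 else [::].
have sX n x : x \in s_ n -> X x.
  elim: n x => [//|n IHn] x /=; rewrite mem_cat => /orP[/IHn//|].
  by have [_ + _] := FP _ IHn; apply.
have s_mono m n x : (m <= n)%N -> x \in s_ m -> x \in s_ n.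
  move=> + xm; elim: n => [|n IHn]; first by rewrite leqn0 => /eqP <-.
  rewrite leq_eqVlt => /orP[/eqP <- //|]; rewrite ltnS => /IHn xn.
  by rewrite /= mem_cat xn.
pose H := pi_map (fun n => (F (s_ n)).1).
(* The N-th coordinate of r (H p) vanishes, but it differs from the N-th entry
   h_N p of H p only by the value at p of a map killing s_ N.+1. *)
have [N NP] := r_ev (H p).
have [tail tail_in tail_out] := cut_exists (fun j => (j <= N)%N) Q.
have [_ _ /(_ (-%R \o (pi_proj Q N \o (r \o (tail \o H)))))] := FP _ (@sX N).
apply.
  move=> x xN /=; rewrite (_ : tail _ = 0) ?linear0 ?oppr0 //.
  apply/funext => j; case: (leqP j N) => jN; first by rewrite tail_in.
  rewrite tail_out; last by apply/negP; rewrite -ltnNge.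
  have [+ _ _] := FP _ (@sX j); apply; exact: (s_mono N.+1).
have headE : r (H p - tail (H p)) = H p - tail (H p).
  apply: r_id; exists N.+1 => j Nj.
  rewrite -[LHS]/(H p j - tail (H p) j) tail_out ?subrr //.
  by apply/negP; rewrite -ltnNge.
have := congr1 (fun f => f N) headE; rewrite linearB.
rewrite -[LHS]/(r (H p) N - r (tail (H p)) N) -[RHS]/(H p N - tail (H p) N).
by rewrite NP // sub0r tail_in // subr0.
Qed.

Lemma finitely_determined_Prod (C Q : lmodType S) : ProdC C Q ->
  finitely_determined C -> finitely_determined Q.
Proof.
move=> [J /direct_summand_retract[u [v uK]]] Cfd M X p.
have [s sX sP] := Cfd M X p; exists s => // h hs t tX.
have /choice[h' h'P] : forall j, exists h' : {linear M -> C}, vanishes_on (s ++ t) h' /\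
    h' p = u (h p) j.
  move=> j; have [|h' h'0 h'p] := sP (pi_proj C j \o (u \o h)) _ t tX; last by exists h'.
  by move=> x xs /=; rewrite hs // linear0.
exists (v \o pi_map h').
  move=> x xst /=; rewrite [X in v X](_ : _ = 0) ?linear0 //.
  by apply/funext => j; have [+ _] := h'P j; apply.
by rewrite /= -[RHS]uK; congr (v _); apply/funext => j; have [_ ->] := h'P j.
Qed.

Section Splitting.
Variables (I : Type) (le : I -> I -> Prop) (Q : lmodType S).
Hypotheses (le_dir : directed le) (Qfd : finitely_determined Q).
Local Notation P := (I -> Q).
Local Open Scope classical_set_scope.

(** The retraction is obtained from partial functions of Q^I that are finitely
    interpolable: on each finite set they agree with some linear map from Q^I
    to the eventually zero families. The inclusion of the eventually zero
    families is one (interpolate by coordinate projections), and a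
    maximal one is total: the value at a new point p is read off from an
    interpolation on a finite set s that determines p in the sense of
    [finitely_determined], applied to each coordinate. *)
Lemma finitely_determined_splits : evzero_splits le Q.
Proof.
pose diag (x : P * P) := evzero le x.1 /\ x.2 = x.1.
pose interp (s : seq (P * P)) := exists2 g : {linear P -> P},
  (forall f, evzero le (g f)) & forall x, x \in s -> g x.1 = x.2.
pose good (G : set (P * P)) := forall s : seq (P * P),
  (forall x, x \in s -> G x \/ diag x) -> interp s.
have interp_diag (s : seq (P * P)) : (forall x, x \in s -> diag x) -> interp s.
  move=> sd; have [|i iP] := @evzero_seq _ _ le_dir _ Q (fun x : P * P => x.1) s.
    by move=> x /sd[].
  have [c c_in c_out] := cut_exists (le i) Q.
  exists c => [f|x xs].
    by exists i => j ij; rewrite c_in.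
  have [_ ->] := sd x xs; apply/funext => j.
  have [ij|ij] := pselect (le i j); last by rewrite c_out.
  by rewrite c_in // iP.
have [|G [Ggood Gmax]] := @Zorn_bigcup _ good.
  move=> F Fgood Ftot s sF.
  have : (forall x, x \in s -> diag x) \/
      exists2 G, F G & forall x, x \in s -> G x \/ diag x.
    elim: s sF => [|x s IHs] sF; first by left.
    have {}IHs := IHs (fun y ys => sF y (mem_behead (s := x :: s) ys)).
    case: (sF x (mem_head x s)) => [[G FG Gx]|dx].
      right; case: IHs => [sd|[G' FG' sG']].
        exists G => // y; rewrite inE => /orP[/eqP->|/sd]; by [left|right].
      case: (Ftot _ _ FG FG') => [GG'|G'G].
        exists G' => // y; rewrite inE => /orP[/eqP->|/sG' //]; by left; apply: GG'.
      exists G => // y; rewrite inE => /orP[/eqP->|/sG'[/G'G|]]; by [left|right].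
    case: IHs => [sd|[G' FG' sG']].
      by left=> y; rewrite inE => /orP[/eqP->|/sd].
    by right; exists G' => // y; rewrite inE => /orP[/eqP->|/sG' //]; right.
  by case=> [/interp_diag //|[G /Fgood]]; apply.
pose R f d := G (f, d) \/ diag (f, d).
have Rinterp (s : seq (P * P)) : (forall x, x \in s -> R x.1 x.2) -> interp s.
  by move=> sR; apply: Ggood => -[f d] /sR.
have Rtot p : exists d, R p d.
  have [s sX sP] := Qfd [set x | exists d, R x d] p.
  have /choice[d dP] : forall x, exists d, x \in s -> R x d.
    by move=> x; have [/sX[d]|] := boolP (x \in s); [exists d|exists 0].
  have [|g0 g0ev g0s] := Rinterp [seq (x, d x) | x <- s].
    by move=> _ /mapP[x /dP + ->].
  exists (g0 p); apply: contrapT => Rpg0.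
  apply: (Gmax (G `|` [set (p, g0 p)])).
    split; first by move=> x; left.
    by move=> /(_ (p, g0 p)) GG; apply: Rpg0; left; apply: GG; right.
  move=> t tG; pose t' := [seq x <- t | `[< R x.1 x.2 >]].
  have t'R x : x \in t' -> R x.1 x.2 by rewrite mem_filter => /andP[/asboolP].
  have [|g1 g1ev g1s] := Rinterp ([seq (x, d x) | x <- s] ++ t').
    by move=> x; rewrite mem_cat => /orP[/mapP[y /dP + ->]|/t'R].
  (* g1 interpolates on s and t' but may miss the value chosen at p; the
     difference h kills s, so its value at p is also that of a map h' killing
     s and t'. *)
  pose h : {linear P -> P} := (g1 \- g0).
  have /choice[k kP] : forall i, exists k : {linear P -> Q},
      vanishes_on (s ++ [seq x.1 | x <- t']) k /\ k p = h p i.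
    move=> i; have [x xs||k k0 kp] := sP (pi_proj Q i \o h) _ [seq x.1 | x <- t'].
    - have xds : (x, d x) \in [seq (x, d x) | x <- s] by apply: map_f.
      have g1x := g1s (x, d x); rewrite /= mem_cat xds in g1x.
      by rewrite /= (g0s _ xds) g1x // subrr.
    - by move=> _ /mapP[x /t'R + ->]; exists x.2.
    - by exists k.
  have [i iP] : evzero le (h p).
    rewrite (_ : h p = (-1) *: g0 p + g1 p); last by rewrite scaleN1r addrC.
    exact: evzero_linear.
  have [c c_in c_out] := cut_exists (le i) Q.
  pose h' : {linear P -> P} := (c \o pi_map k).
  have h'p : h' p = h p.
    apply/funext => j; rewrite -[LHS]/(c (pi_map k p) j).
    have [ij|ij] := pselect (le i j); first by rewrite c_in // iP.
    by rewrite c_out //; have [_ <-] := kP j.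
  exists (g1 \- h').
    move=> f /=; rewrite (_ : _ - _ = (-1) *: h' f + g1 f); last first.
      by rewrite scaleN1r addrC.
    by apply: evzero_linear => //; exists i => j ij; rewrite /h' /= c_in.
  move=> x xt; have [Rx|Rx] := pselect (R x.1 x.2).
    have xt' : x \in t' by rewrite mem_filter xt andbT; apply/asboolP.
    rewrite -[LHS]/(g1 x.1 - h' x.1) g1s ?mem_cat ?xt' ?orbT // (_ : h' _ = 0) ?subr0 //.
    rewrite -[LHS]/(c (pi_map k x.1)) (_ : pi_map k x.1 = 0) ?linear0 //.
    apply/funext => j; have [+ _] := kP j; apply.
    by rewrite mem_cat map_f ?orbT.
  have -> : x = (p, g0 p).
    have [[Gx|//]|dx] := tG x xt; case: Rx; rewrite /R -surjective_pairing.
      by left.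
    by right.
  by rewrite -[LHS]/(g1 p - h' p) h'p /h /= opprB addrC subrK.
have [||k f f' d d' Rd Rd'|r rP] := @linear_of_graph _ P P R.
- exact: Rtot.
- move=> d Rd; have [|g _ gs] := Rinterp [:: (0, d)].
    by move=> x; rewrite inE => /eqP->.
  by have := gs _ (mem_head _ _); rewrite /= linear0.
- have [c Rc] := Rtot (k *: f + f').
  have [|g _ gs] := Rinterp [:: (f, d); (f', d'); (k *: f + f', c)].
    by move=> x; rewrite !inE => /or3P[]/eqP->.
  have <- : c = k *: d + d' => //.
  have gf : g f = d by apply: (gs (f, d)); rewrite inE eqxx.
  have gf' : g f' = d' by apply: (gs (f', d')); rewrite !inE eqxx orbT.
  have gc : g (k *: f + f') = c by apply: (gs (_, c)); rewrite !inE eqxx !orbT.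
  by rewrite -gc linearP gf gf'.
exists r; split=> [f|f fev]; last by apply/rP; right.
have [|g gev gs] := Rinterp [:: (f, r f)].
  by move=> x; rewrite inE => /eqP-> /=; apply/rP.
have <- : g f = r f by apply: (gs (f, r f)); rewrite inE.
exact: gev.
Qed.
End Splitting.

End EventuallyZero.

(** * Modules cogenerated by C *)

Section Cogenerated.
Variables (S : pzRingType) (C : lmodType S).
Implicit Types B M N Q : lmodType S.

Definition cogenerated M : Prop :=
  forall x : M, x <> 0 -> exists h : {linear M -> C}, h x <> 0.

(** [A] is the intersection of the kernels of the maps to [C] that kill it; that
    is, C cogenerates B / A. *)
Definition annihilator_closed B (A : set B) : Prop :=
  forall b, ~ A b -> exists2 h : {linear B -> C}, forall a, A a -> h a = 0 & h b <> 0.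

(** Evaluation embeds [M] in a power of [C]. *)
Lemma cogenerated_ext_vanishes M : inj_dim_le1 C ->
  (forall I : Type, ext_vanishes (I -> C) C) -> cogenerated M -> ext_vanishes M C.
Proof.
move=> idC extC cogM.
apply: (@ext_vanishes_sub _ _ _ _ (pi_map (fun h : {linear M -> C} => h))) (extC _) => //.
move=> x y xy; apply: contrapT => neq_xy.
have [|h] := cogM (x - y); first by move/eqP; rewrite subr_eq0 => /eqP.
by apply; have /= hxy := congr1 (fun F => F h) xy; rewrite linearB hxy subrr.
Qed.

Lemma quotient_cogenerated B N (A : set B) (p : {linear B -> N}) :
  is_surjective p -> (forall b, p b = 0 <-> A b) ->
  annihilator_closed A -> cogenerated N.
Proof.
move=> p_surj pA clA y y0; have [b pb] := p_surj y.
have [|h hA hb] := clA b; first by move/pA; rewrite pb.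
have [|g gP] := @factor_through _ _ _ _ p h p_surj; first by move=> a /pA/hA.
by exists g; rewrite -pb gP.
Qed.

(** For b outside the union choose for each i a map h_i killing A_i and not b.
    The map (h_i) sends the union to eventually zero families and b to a family
    without zero entries; remove its eventually zero part by the splitting. *)
Lemma annihilator_closed_directed_union B (I : Type) (le : I -> I -> Prop)
    (A : I -> set B) :
  directed le -> finitely_determined C ->
  (forall i j, le i j -> (A i `<=` A j)%classic) ->
  (forall i, annihilator_closed (A i)) ->
  annihilator_closed (\bigcup_i A i)%classic.
Proof.
move=> le_dir fdC A_mono clA b Ab.
have /choice[h hP] : forall i, exists h : {linear B -> C},
    (forall a, A i a -> h a = 0) /\ h b <> 0.
  move=> i; have [|h hA hb] := clA i b; last by exists h.
  by move=> Aib; apply: Ab; exists i.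
have [r [r_ev r_id]] := finitely_determined_splits le_dir fdC.
pose k : {linear B -> (I -> C)} := pi_map h \- (r \o pi_map h).
have kA a : (\bigcup_i A i)%classic a -> k a = 0.
  move=> [i _ Aa]; rewrite -[LHS]/(pi_map h a - r (pi_map h a)) r_id ?subrr //.
  by exists i => j ij; have [+ _] := hP j; apply; apply: A_mono Aa.
have [i ki] : exists i, k b i <> 0.
  apply: contrapT => kb; have [i iP] := r_ev (pi_map h b).
  have [_ _ /(_ i i)[j [ij _]]] := le_dir; have [_] := hP j; apply.
  have hE : h j b = k b j + r (pi_map h b) j by rewrite subrK.
  by rewrite hE iP // addr0; apply: contrapT => kj; apply: kb; exists j.
by exists (pi_proj C i \o k) => // a /kA ka; rewrite -[LHS]/(k a i) ka.
Qed.

Lemma ProdC_cogenerated Q : ProdC C Q -> cogenerated Q.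
Proof.
move=> [J /direct_summand_retract[u [v uK]]] x x0; apply: contrapT => noh.
apply: x0; rewrite -(uK x) (_ : u x = 0) ?linear0 //; apply/funext => j.
by apply: contrapT => uxj; apply: noh; exists (pi_proj C j \o u).
Qed.

End Cogenerated.

(** * Finitely generated modules in the cotilting class *)

Section Cotilting.
Variables (S : pzRingType) (C : lmodType S).
Hypotheses (C_cot : cotilting1 C) (C_fd : finitely_determined C).
Implicit Types B F M N X : lmodType S.

Let C_id : inj_dim_le1 C. Proof. by have [] := C_cot. Qed.

Let C_prod (I : Type) : ext_vanishes (I -> C) C.
Proof. by have [C_pi _ _] := C_cot; apply/ext1_vanishes/C_pi. Qed.

(** A map M -> W that is nonzero at x lifts to a map M -> C0. *)
Lemma cotilting_classP M : ext_vanishes M C <-> cogenerated C M.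
Proof.
split; last exact: cogenerated_ext_vanishes.
have [_ _ [C1 [C0 [W [i [p [PC1 PC0 [_ W_cog] ip]]]]]]] := C_cot.
move=> MC x x0; have [f fx] := W_cog _ _ x0.
have [g gP] := ext_vanishes_lift f (ext_vanishes_Prod PC1 MC) ip.
have [|h hx] := ProdC_cogenerated PC0 (x := g x).
  by move=> gx0; apply: fx; rewrite -gP gx0 linear0.
by exists (h \o g).
Qed.

Lemma cotilting_lperp_infty M : lperp_infty (eq C) M <-> ext_vanishes M C.
Proof.
split=> [CM|CM _ <- [//|[|j]] _]; first exact/ext1_vanishes/CM.
  exact/ext1_vanishes.
exact: inj_dim_le1_ext_higher.
Qed.

(** With K = ker q, the maps h_s : K -> W indexed by the finite subsets s of K
    form a map from K to the eventually zero families of W, as a is killed by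
    h_s whenever s contains a. It lifts to the eventually zero families of C0,
    since those of C1 are a summand of a power of C1. The lift extends to N, and
    there the values on the finite set [l] all vanish beyond one index s0; so do
    those on K, hence h_s0 = 0. *)
Lemma kernel_finitely_generated N M (q : {linear N -> M}) (l : seq N) :
  is_surjective q -> ext_vanishes N C -> ext_vanishes M C ->
  (forall h : {linear N -> C}, vanishes_on l h -> forall x, q x = 0 -> h x = 0) ->
  finitely_generated (kernel_mod q).
Proof.
move=> q_surj NC MC l_det; apply: contrapT => nfg.
have [_ _ [C1 [C0 [W [i [p [PC1 PC0 W_cog ip]]]]]]] := C_cot.
have [i_inj ipP _] := ip.
pose K : lmodType S := kernel_mod q; pose v : {linear K -> N} := \val.
have KC : ext_vanishes K C.
  by apply: (@ext_vanishes_sub _ _ _ _ v) => //; apply: val_inj.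
have vq : short_exact v q by split=> //; apply: kernel_valP.
pose le (s t : seq K) : Prop := {subset s <= t}.
have le_dir : directed le.
  split; [exact: inhabits [::]|by move=> s t w st tw x /st/tw|].
  by move=> s t; exists (s ++ t); split=> x; rewrite mem_cat => ->; rewrite ?orbT.
have [r0 [r0_ev r0_id]] :=
  finitely_determined_splits le_dir (finitely_determined_Prod PC0 C_fd).
have [r1 [r1_ev r1_id]] :=
  finitely_determined_splits le_dir (finitely_determined_Prod PC1 C_fd).
have /choice[h hP] : forall s : seq K, exists h : {linear K -> W},
    vanishes_on s h /\ exists x, h x <> 0.
  by move=> s; have [h ? ?] := vanishing_map_exists W_cog nfg s; exists h.
have /choice[k kP] : forall s, exists k : {linear K -> C0}, forall x, p (k x) = h s x.
  move=> s; exact: ext_vanishes_lift (ext_vanishes_Prod PC1 KC) ip.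
(* The coordinatewise lift k is eventually in C1 only. Write it as i c up to an
   eventually zero family; psi is the complement of the eventually zero part of
   c, which does not depend on the choice of c, and k - i psi is eventually
   zero. *)
have [|||psi psiP] := @linear_of_graph _ K (seq K -> C1) (fun a y =>
    exists2 c : seq K -> C1, evzero le (fun s => k s a - i (c s)) & y = c - r1 c).
- move=> a; have /choice[c cP] : forall s, exists c, a \in s -> i c = k s a.
    move=> s; have [as_|_] := boolP (a \in s); last by exists 0.
    have /ipP[c cP] : p (k s a) = 0 by rewrite kP; have [+ _] := hP s; apply.
    by exists c.
  exists (c - r1 c), c => //; exists [:: a] => s sa.
  by rewrite cP ?subrr //; apply: sa; rewrite inE.
- move=> y [c [s sP] ->]; rewrite r1_id ?subrr //; exists s => t /sP.
  by rewrite linear0 sub0r => /eqP; rewrite oppr_eq0 -(linear0 i) => /eqP/i_inj.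
- move=> n a a' _ _ [c cP ->] [c' c'P ->]; exists (n *: c + c').
    have := evzero_linear le_dir n cP c'P; congr evzero; apply/funext => s.
    rewrite -[LHS]/(n *: (k s a - i (c s)) + (k s a' - i (c' s))).
    rewrite -[(n *: c + c') s]/(n *: c s + c' s) !linearP.
    by rewrite scalerDr addrACA.
  by rewrite linearP scalerBr opprD addrACA.
pose k' s : {linear K -> C0} := k s \- (i \o (pi_proj C1 s \o psi)).
have k'_ev a : evzero le (pi_map k' a).
  have [c c_ev psia] := (psiP a (psi a)).2 erefl.
  have ir1c : evzero le (fun s => i (r1 c s)).
    by have [s sP] := r1_ev c; exists s => t /sP ->; rewrite linear0.
  have := evzero_linear le_dir 1 c_ev ir1c; congr evzero; apply/funext => s.
  rewrite -[LHS]/(1 *: (k s a - i (c s)) + i (r1 c s)) scale1r.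
  rewrite -[RHS]/(k s a - i (psi a s)) psia -[(c - r1 c) s]/(c s - r1 c s).
  by rewrite linearB opprB addrA addrAC.
have k'P s a : p (k' s a) = h s a.
  rewrite -[k' s a]/(k s a - i (psi a s)) linearB kP (_ : p (i _) = 0) ?subr0 //.
  by apply/ipP; eexists.
have /choice[g gP] : forall s, exists g : {linear N -> C0}, forall a, g (v a) = k' s a.
  move=> s; exact: (ext_vanishes_Prod PC0 MC vq).
have [s0 s0P] := @evzero_seq _ _ _ le_dir _ C0 (r0 \o pi_map g) l (fun x _ => r0_ev _).
have [_ [y hy]] := hP s0; apply: hy; rewrite -k'P.
rewrite (_ : k' s0 y = 0) ?linear0 // -[LHS]/(pi_map k' y s0) -(r0_id (pi_map k' y)) //.
have -> : pi_map k' y = pi_map g (v y) by apply/funext => s; rewrite /= gP.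
apply: contrapT => /(ProdC_cogenerated PC0)[f]; apply.
apply: (l_det (f \o (pi_proj C0 s0 \o (r0 \o pi_map g)))).
  by move=> x xl; rewrite -[LHS]/(f ((r0 \o pi_map g) x s0)) s0P ?linear0.
by apply/kernel_valP; exists y.
Qed.

(** Apply [kernel_finitely_generated] to a free cover of [F] of finite rank, with
    [l] the standard basis. *)
Lemma finitely_generated_presented F : ext_vanishes F C ->
  finitely_generated F -> finitely_presented F.
Proof.
move=> FC [n [q q_surj]].
have [|||m [r r_surj]] :=
    @kernel_finitely_generated _ _ q [seq delta_mx 0 i | i <- enum 'I_n] q_surj.
- exact/projective_ext_vanishes/rV_projective.
- exact: FC.
- move=> h hl x _; apply: (@rV_linear_ext _ _ _ h \0) => j; apply: hl.
  by apply: map_f; rewrite mem_enum.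
exists m, n, (\val \o r), q; split=> // y; rewrite kernel_valP.
split=> [[x <-]|[x <-]]; last by exists (r x).
by have [u <-] := r_surj x; exists u.
Qed.

Lemma cotilting_coherent : left_coherent S.
Proof.
move=> M i i_inj; apply: finitely_generated_presented.
apply: ext_vanishes_sub i_inj _ => //.
exact/projective_ext_vanishes/regular_projective.
Qed.

(** * A relative Baer criterion *)

Section Baer.
Variable X : lmodType S.
Hypothesis X_perp : forall F,
  finitely_presented F -> ext_vanishes F C -> ext_vanishes F X.
Local Open Scope classical_set_scope.

Section Extension.
Variables (A B M : lmodType S) (i : {linear A -> B}) (f : {linear A -> X}).

Definition domain (G : set (B * X)) : set B := [set b | exists x, G (b, x)].

(** The graphs of the linear extensions of [f] to submodules A' of [B] with
    B / A' cogenerated by [C]. *)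
Definition closed_extension (G : set (B * X)) : Prop :=
  [/\ forall a, G (i a, f a), submodule_set G, forall x, G (0, x) -> x = 0 &
      annihilator_closed C (domain G)].

Lemma closed_extension_union (F : set (set (B * X))) :
  F !=set0 -> F `<=` closed_extension -> total_on F subset ->
  closed_extension (\bigcup_(G in F) G).
Proof.
move=> [G0 FG0] Fcl Ftot; split.
- by move=> a; exists G0 => //; have [+ _ _ _] := Fcl _ FG0; apply.
- split; first by exists G0 => //; have [_ [+ _] _ _] := Fcl _ FG0.
  have FD (G : set (B * X)) k x y : F G -> G x -> G y ->
      (\bigcup_(G in F) G) (k *: x + y).
    by move=> FG Gx Gy; exists G => //; have [_ [_ Glin] _ _] := Fcl _ FG; apply: Glin.
  move=> k x y [G FG Gx] [G' FG' G'y].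
  have [/(_ _ Gx) G'x|/(_ _ G'y) Gy] := Ftot _ _ FG FG'.
    exact: FD FG' G'x G'y.
  exact: FD FG Gx Gy.
- by move=> x [G /Fcl[_ _ + _]]; apply.
pose le (G G' : {G | F G}) := sval G `<=` sval G'.
have le_dir : directed le.
  split; first exact: (inhabits (exist _ G0 FG0)).
    by move=> G G' G''; apply: subset_trans.
  move=> G G'; have [GG'|G'G] := Ftot _ _ (svalP G) (svalP G').
    by exists G'; split=> // x.
  by exists G; split=> // x.
have -> : domain (\bigcup_(G in F) G) = \bigcup_(G : {G | F G}) domain (sval G).
  apply/seteqP; split=> b.
    by case=> x [G FG Gx]; exists (exist _ G FG) => //; exists x.
  by case=> G _ [x Gx]; exists x, (sval G) => //; apply: (svalP G).
apply: (annihilator_closed_directed_union le_dir) => //.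
  by move=> G G' GG' b [x /GG']; exists x.
by move=> G; have [] := Fcl _ (svalP G).
Qed.

(** [N] is the quotient of [B] by the domain of [G], and [F] the intersection of
    the kernels of the maps N -> C that kill the class of [b0]. The preimage A2
    of F in B is an extension of F by the domain A1 of G, and
    Ext^1(F, X) = 0 extends the map along A1 -> A2. *)
Lemma closed_extension_step (G : set (B * X)) b0 : closed_extension G ->
  ~ domain G b0 -> exists2 G', closed_extension G' & G `<` G'.
Proof.
move=> [Gf [G0 Glin] Gfun Gcl] Gb0.
have [N [p [p_surj pP]]] : exists (N : lmodType S) (p : {linear B -> N}),
    is_surjective p /\ forall b, p b = 0 <-> domain G b.
  apply: quotient_exists; split=> [|k b b' [x Gx] [x' Gx']]; first by exists 0.
  by exists (k *: x + x'); apply: Glin Gx Gx'.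
have NC : ext_vanishes N C by apply/cotilting_classP/(quotient_cogenerated p_surj pP).
pose U := [set n : N | forall h : {linear N -> C}, h (p b0) = 0 -> h n = 0].
have [M' [q [q_surj qP]]] : exists (M' : lmodType S) (q : {linear N -> M'}),
    is_surjective q /\ forall n, q n = 0 <-> U n.
  apply: quotient_exists; split=> [h _|k n n' Un Un' h h0]; first by rewrite linear0.
  by rewrite linearP Un // Un' // scaler0 addr0.
have M'cog : cogenerated C M'.
  apply: (quotient_cogenerated q_surj qP) => n Un.
  apply: contrapT => nh; apply: Un => h h0; apply: contrapT => hn; apply: nh.
  by exists h => // u; apply.
pose F : lmodType S := kernel_mod q.
have FC : ext_vanishes F C.
  by apply: (@ext_vanishes_sub _ _ _ _ (\val : F -> N)) NC => //; apply: val_inj.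
have Ffg : finitely_generated F.
  apply: (@kernel_finitely_generated _ _ q [:: p b0]) => //; first exact/cotilting_classP.
  by move=> h hb x /qP; apply; apply: hb; rewrite inE.
have FX := X_perp (finitely_generated_presented FC Ffg) FC.
pose A2 : lmodType S := kernel_mod (q \o p).
have A2P b : q (p b) = 0 <-> exists a : A2, \val a = b := kernel_valP (q \o p) b.
have [|w wP] := @factor_into _ A2 F N \val (p \o \val) val_inj.
  by move=> a; apply/kernel_valP/A2P; exists a.
have w_surj : is_surjective w.
  move=> y; have [b pb] := p_surj (\val y).
  have /A2P[a ab] : q (p b) = 0 by rewrite pb; apply/kernel_valP; exists y.
  by exists a; apply: val_inj; rewrite wP /= ab.
pose A1 : lmodType S := kernel_mod w.
have A1P (a : A2) : domain G (\val a) <-> exists a1 : A1, \val a1 = a.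
  rewrite -kernel_valP -pP -[p _]/((p \o \val) a) -wP.
  by split=> [a0|->//]; apply: val_inj.
have [|||f' f'P] := @linear_of_graph _ A1 X (fun a x => G (\val (\val a), x)).
- by move=> a; apply/A1P; exists a.
- exact: Gfun.
- by move=> k a a' x x' Gx Gx'; apply: Glin Gx Gx'.
have [|g gP] := FX A1 A2 \val w _ f'.
  by split=> //; apply: kernel_valP.
pose G' := [set z : B * X | exists a : A2, (\val a : B, g a) = z].
have GG' : G `<=` G'.
  move=> [b x] Gbx; have Gb : domain G b by exists x.
  have /A2P[a ab] : q (p b) = 0 by rewrite ((pP b).2 Gb) linear0.
  have /A1P[a1 a1a] : domain G (\val a) by rewrite ab.
  exists a; rewrite ab; congr pair; rewrite -a1a gP; apply/f'P.
  by rewrite a1a ab.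
exists G'; last first.
  split=> // G'G; apply: Gb0.
  have /A2P[a ab] : q (p b0) = 0 by apply/qP.
  by exists (g a); apply: G'G; exists a; rewrite ab.
split.
- by move=> a; apply: GG'.
- split; first by apply: GG'.
  move=> k _ _ [a <-] [a' <-]; exists (k *: a + a').
  by rewrite [g _]linearP.
- move=> x [a [a0 <-]]; rewrite (_ : a = 0) ?linear0 //; exact: val_inj.
move=> b Gb; have [|h hb] := M'cog (q (p b)).
  by move=> /A2P[a ab]; apply: Gb; exists (g a), a; rewrite ab.
exists (h \o (q \o p)) => // c [x [a [ac _]]] /=.
by rewrite (_ : q _ = 0) ?linear0 //; apply/A2P; exists a.
Qed.

End Extension.

(** Baer's criterion relative to the cotilting class. *)
Lemma cotilting_ext_vanishes_perp M : ext_vanishes M C -> ext_vanishes M X.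
Proof.
move=> /cotilting_classP Mcog A B i p [i_inj ip p_surj] f.
have f_ext : closed_extension i f [set z | exists a, (i a, f a) = z].
  split; first by move=> a; exists a.
  - split=> [|k _ _ [a <-] [a' <-]]; first by exists 0; rewrite !linear0.
    by exists (k *: a + a'); rewrite !linearP.
  - by move=> x [a [+ <-]]; rewrite -(linear0 i) => /i_inj ->; rewrite linear0.
  move=> b nb; have [|h hb] := Mcog (p b).
    by move=> /ip[a ab]; apply: nb; exists (f a), a; rewrite ab.
  exists (h \o p) => // c [x [a [ac _]]] /=.
  by rewrite (_ : p c = 0) ?linear0 //; apply/ip; exists a.
(* The empty graph is admitted because Zorn's lemma also asks for the union of
   the empty chain. *)
pose P (G : set (B * X)) := G !=set0 -> closed_extension i f G.
have [|G [PG Gmax]] := @Zorn_bigcup _ P.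
  move=> F FP Ftot [z [G0 FG0 G0z]].
  pose F' := [set G | F G /\ G !=set0].
  have -> : \bigcup_(G in F) G = \bigcup_(G in F') G.
    apply/seteqP; split=> y [G]; last by case=> FG _ Gy; exists G.
    by move=> FG Gy; exists G => //; split=> //; exists y.
  apply: closed_extension_union.
  - by exists G0; split=> //; exists z.
  - by move=> G [/FP PG /PG].
  - by move=> G G' [FG _] [FG' _]; apply: Ftot.
have G_ext : closed_extension i f G.
  apply: PG; apply: contrapT => G0; apply: Gmax (fun=> f_ext).
  split; first by move=> z Gz; case: G0; exists z.
  by move=> /(_ (i 0, f 0)) GG; apply: G0; exists (i 0, f 0); apply: GG; exists 0.
have [Gf [G0 Glin] Gfun _] := G_ext.
have [|||g gP] := @linear_of_graph _ B X (fun b x => G (b, x)).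
- move=> b; apply: contrapT => Gb.
  by have [G' G'_ext GG'] := closed_extension_step G_ext Gb; apply: Gmax GG' _.
- exact: Gfun.
- by move=> k b b' x x' Gx Gx'; apply: Glin Gx Gx'.
by exists g => a; apply/gP.
Qed.

End Baer.
End Cotilting.

(** * The two cotorsion pairs and coherence *)

Theorem corollary3p4 (R : pzRingType) (C : rmodType R) :
  cotilting1 C -> Sigma_pure_injective C ->
  let Y : mod_class R^c := lperp_infty (eq C) in
  let Y1 : mod_class R^c := fp_part Y in
  (Y, rperp Y) = generated_pair Y1 /\ right_coherent R.
Proof.
move=> C_cot C_spi Y Y1.
have C_fd := splits_finitely_determined (Sigma_pure_injective_splits C_spi).
have YP := cotilting_lperp_infty C_cot.
split; last exact: cotilting_coherent C_cot C_fd.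
have YY1 : rperp Y1 = rperp Y.
  apply/funext => X; apply/propext; split=> XY M; last by case=> _; apply: XY.
  move=> /YP MC; apply/ext1_vanishes.
  apply: cotilting_ext_vanishes_perp MC => // F Ffp FC.
  by apply/ext1_vanishes/XY; split=> //; apply/YP.
rewrite /generated_pair YY1; congr pair; apply/funext => M; apply/propext.
split=> [YM X XY|MY]; first exact: XY.
by apply/YP/ext1_vanishes/MY => F /YP FC; apply/ext1_vanishes.
Qed.
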